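(* For any $n\ge3$, the transformations $R^\hbar_{i,i+1}$, $1\le i\le n-1$, acting on the matrix $\mathcal A^\hbar$ of quantum geodesic functions of the $A_n$-algebra satisfy the quantum braid group relations $$R^\hbar_{i-1,i}R^\hbar_{i,i+1}R^\hbar_{i-1,i}=R^\hbar_{i,i+1}R^\hbar_{i-1,i}R^\hbar_{i,i+1},\qquad 2\le i\le n-1,$$ $$\bigl(R^\hbar_{n-1,n}R^\hbar_{n-2,n-1}\cdots R^\hbar_{2,3}R^\hbar_{1,2}\bigr)^n=\mathrm{Id}.$$
   Context: Let $q=e^{-i\pi\hbar}$ with $\hbar>0$, and $\xi=q^2-q^{-2}$. The quantum geodesic functions $G^\hbar_{i,j}$, $1\le i<j\le n$, of the disc with $n$ marked points are noncommuting quantities (elements of an associative $\mathbb C$-algebra) satisfying, for $i<j<k$, $$qG^\hbar_{i,j}G^\hbar_{j,k}-q^{-1}G^\hbar_{j,k}G^\hbar_{i,j}=\xi G^\hbar_{i,k},\quad qG^\hbar_{j,k}G^\hbar_{i,k}-q^{-1}G^\hbar_{i,k}G^\hbar_{j,k}=\xi G^\hbar_{i,j},\quad qG^\hbar_{i,k}G^\hbar_{i,j}-q^{-1}G^\hbar_{i,j}G^\hbar_{i,k}=\xi G^\hbar_{j,k},$$ and, for $i<j<k<l$, $$[G^\hbar_{i,j},G^\hbar_{k,l}]=0,\qquad [G^\hbar_{i,l},G^\hbar_{j,k}]=0,\qquad [G^\hbar_{i,k},G^\hbar_{j,l}]=\xi\bigl(G^\hbar_{i,l}G^\hbar_{j,k}-G^\hbar_{i,j}G^\hbar_{k,l}\bigr).$$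 $\mathcal A^\hbar$ is the upper-triangular $n\times n$ matrix with $q$ on the diagonal and $G^\hbar_{i,j}$ at the places $i<j$. The transformation $R^\hbar_{i,i+1}$ sends it to the matrix of the same form with entries $$\tilde G^\hbar_{i+1,j}=G^\hbar_{i,j}\ (j>i+1),\qquad \tilde G^\hbar_{j,i+1}=G^\hbar_{j,i}\ (j<i),\qquad \tilde G^\hbar_{i,i+1}=G^\hbar_{i,i+1},$$ $$\tilde G^\hbar_{i,j}=qG^\hbar_{i,j}G^\hbar_{i,i+1}-q^2G^\hbar_{i+1,j}=q^{-1}G^\hbar_{i,i+1}G^\hbar_{i,j}-q^{-2}G^\hbar_{i+1,j}\ (j>i+1),$$ $$\tilde G^\hbar_{j,i}=qG^\hbar_{j,i}G^\hbar_{i,i+1}-q^2G^\hbar_{j,i+1}=q^{-1}G^\hbar_{i,i+1}G^\hbar_{j,i}-q^{-2}G^\hbar_{j,i+1}\ (j<i),$$ all other entries being unchanged (the two expressions in each line coincide by the relations above). In a product of transformations the rightmost one is applied first, and each subsequent transformation is applied to the matrix obtained at the previous step (its formulas use the transformed entries). *)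

(* Defs.v *)
(* MathComp / MathComp-Analysis *)
From HB Require Import structures.
From mathcomp Require Import all_boot all_order all_algebra.
From mathcomp Require Import reals trigo.
From mathcomp Require Import complex.

Set Implicit Arguments.
Unset Strict Implicit.
Unset Printing Implicit Defensive.

Import Order.TTheory GRing.Theory Num.Theory.
Local Open Scope ring_scope.
Local Open Scope complex_scope.

(* e^{-i pi hbar}, by Euler's formula *)
Definition qh (R : realType) (hbar : R) : R[i] :=
  cos (pi * hbar) -i* sin (pi * hbar).

Definition xih (R : realType) (hbar : R) : R[i] :=
  qh hbar ^+ 2 - qh hbar ^- 2.

(* The marked points 1, ..., n are the elements 0, ..., n - 1 of 'I_n.
   Only the values G i j with i < j are meaningful. *)
Record quantum_geodesic_functions (R : realType) (hbar : R)
    (A : algType R[i]) (n : nat) (G : 'I_n -> 'I_n -> A) : Prop := {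
  qgeod_ij_jk : forall i j k : 'I_n, (i < j < k)%N ->
    qh hbar *: (G i j * G j k) - (qh hbar)^-1 *: (G j k * G i j)
      = xih hbar *: G i k;
  qgeod_jk_ik : forall i j k : 'I_n, (i < j < k)%N ->
    qh hbar *: (G j k * G i k) - (qh hbar)^-1 *: (G i k * G j k)
      = xih hbar *: G i j;
  qgeod_ik_ij : forall i j k : 'I_n, (i < j < k)%N ->
    qh hbar *: (G i k * G i j) - (qh hbar)^-1 *: (G i j * G i k)
      = xih hbar *: G j k;
  qgeod_ij_kl : forall i j k l : 'I_n, [&& i < j, j < k & k < l]%N ->
    G i j * G k l - G k l * G i j = 0;
  qgeod_il_jk : forall i j k l : 'I_n, [&& i < j, j < k & k < l]%N ->
    G i l * G j k - G j k * G i l = 0;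
  qgeod_ik_jl : forall i j k l : 'I_n, [&& i < j, j < k & k < l]%N ->
    G i k * G j l - G j l * G i k
      = xih hbar *: (G i l * G j k - G i j * G k l) }.

Definition qmatrix (R : realType) (hbar : R) (A : algType R[i]) (n : nat)
    (G : 'I_n -> 'I_n -> A) : 'M[A]_n :=
  \matrix_(a, b) (if (a < b)%N then G a b
                  else if a == b then (qh hbar)%:A else 0).

Definition ord_lo (n : nat) (k : 'I_n.-1) : 'I_n := widen_ord (leq_pred n) k.

Lemma ord_hi_subproof (n : nat) (k : 'I_n.-1) : (k.+1 < n)%N.
Proof. by case: n k => [|n] [k]. Qed.

Definition ord_hi (n : nat) (k : 'I_n.-1) : 'I_n :=
  Ordinal (ord_hi_subproof k).

(* The transformation R_{i,i+1} for i = ord_lo k, i + 1 = ord_hi k.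
   qmatrix only reads the entries (a, b) with a < b, so that in the second test
   b > i + 1, in the third a < i, and likewise for the last two; of the two
   equivalent expressions for the new entries the first one is used, see
   qbraid_entry_row and qbraid_entry_col. *)
Definition qbraid (R : realType) (hbar : R) (A : algType R[i]) (n : nat)
    (k : 'I_n.-1) (M : 'M[A]_n) : 'M[A]_n :=
  let q := qh hbar in
  let i := ord_lo k in
  let i1 := ord_hi k in
  qmatrix hbar (fun a b =>
    if (a == i) && (b == i1) then M i i1
    else if a == i1 then M i b
    else if b == i1 then M a i
    else if a == i then q *: (M i b * M i i1) - q ^+ 2 *: M i1 b
    else if b == i then q *: (M a i * M i i1) - q ^+ 2 *: M a i1
    else M a b).

(* R_{n-1,n} \o ... \o R_{2,3} \o R_{1,2} : index 0 acts first *)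
Definition qbraid_cycle (R : realType) (hbar : R) (A : algType R[i]) (n : nat) :
    'M[A]_n -> 'M[A]_n :=
  \big[(fun f g : 'M[A]_n -> 'M[A]_n => f \o g) / id]_(k <- rev (enum 'I_n.-1))
    qbraid hbar k.

Lemma qexchange (R : realType) (hbar : R) (A : algType R[i]) (x y z : A) :
  qh hbar *: (x * y) - (qh hbar)^-1 *: (y * x) = xih hbar *: z ->
  qh hbar *: (x * y) - qh hbar ^+ 2 *: z
    = (qh hbar)^-1 *: (y * x) - qh hbar ^- 2 *: z.
Proof.
rewrite /xih scalerBl => /eqP; rewrite subr_eq => /eqP ->.
by rewrite addrAC [X in X + _]addrAC subrr add0r addrC.
Qed.

Lemma qbraid_entry_row (R : realType) (hbar : R) (A : algType R[i]) (n : nat)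
    (G : 'I_n -> 'I_n -> A) (i i1 j : 'I_n) :
  quantum_geodesic_functions hbar G -> (i < i1 < j)%N ->
  qh hbar *: (G i j * G i i1) - qh hbar ^+ 2 *: G i1 j
    = (qh hbar)^-1 *: (G i i1 * G i j) - qh hbar ^- 2 *: G i1 j.
Proof. by move=> hG lt_ij; apply/qexchange/(qgeod_ik_ij hG). Qed.

Lemma qbraid_entry_col (R : realType) (hbar : R) (A : algType R[i]) (n : nat)
    (G : 'I_n -> 'I_n -> A) (i i1 j : 'I_n) :
  quantum_geodesic_functions hbar G -> (j < i < i1)%N ->
  qh hbar *: (G j i * G i i1) - qh hbar ^+ 2 *: G j i1
    = (qh hbar)^-1 *: (G i i1 * G j i) - qh hbar ^- 2 *: G j i1.
Proof. by move=> hG lt_ij; apply/qexchange/(qgeod_ij_jk hG). Qed.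

(* Main.v *)
Require Import Defs.
From HB Require Import structures.
From mathcomp Require Import all_boot all_order all_algebra.
From mathcomp Require Import reals trigo.
From mathcomp Require Import complex.
From mathcomp Require Import zify.
Local Open Scope ring_scope.
Local Open Scope complex_scope.

Set Implicit Arguments.
Unset Strict Implicit.
Unset Printing Implicit Defensive.

Import Order.TTheory GRing.Theory Num.Theory.

(** A geodesic function belongs to an unordered pair of marked points on a
    circle, so [G] is best read through the symmetric function [chord G].  In
    that reading the three relations on a triple i < j < k are one and the same
    relation, [skein], imposed on all cyclically ordered triples, and both parts
    of the theorem follow from [skein].

    Braid relation.  Away from the three consecutive points x < y < z involved,
    both sides send the three chords joining a fourth point to x, y, z to the
    same expressions: each new entry is linear in these three chords, with
    coefficients on the right, and it suffices to compare the coefficients,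
    which come from the triangle x y z.  There one has to see that exchanging a
    side twice, across its two neighbours in either order, gives it back
    ([qexchange_cancel]).  On one side of the braid relation this is used in the
    original triangle, on the other in the triangle in which x z has been
    replaced by its image under the twist of y and z; that the exchange relation
    persists there is [qexchange_mutation].

    Cyclic relation.  The product R_{n-1,n} ... R_{1,2} carries the first marked
    point past all the others, hence rotates the circle by one step.  To prove
    it one follows the matrix during this motion: after m half twists the entry
    of a pair of points is the chord joining them in the old labelling, except
    when the moving point lies between the two, in which case it is the exchange
    expression of that chord with respect to the moving point ([swept],
    [half_twist_swept]).  At the end the moving point is the last one and lies
    between no two others, and the entries are those of [rotate].  The symmetric
    form of [skein] is visibly invariant under rotation, so the argument can be
    repeated, and n rotations by one step are the identity on n points. *)

(** * Chords and the skein relation *)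

Section QuantumBraid.

Context (R : realType) (hbar : R) (A : algType R[i]) (n : nat).
Local Notation q := (qh hbar).
Local Notation arcs := ('I_n -> 'I_n -> A).
Implicit Types (F G : arcs) (a b i j k x y z : 'I_n).

Lemma qh_neq0 : q != 0.
Proof.
apply/eqP => /eqP; rewrite eq_complex /= oppr_eq0 => /andP[/eqP c0 /eqP s0].
have /eqP := cos2Dsin2 (pi * hbar).
by rewrite c0 s0 expr0n addr0 eq_sym oner_eq0.
Qed.

Lemma qmatrixE F a b : (a < b)%N -> qmatrix hbar F a b = F a b.
Proof. by move=> lt_ab; rewrite mxE lt_ab. Qed.

Lemma eq_qmatrix F G :
  (forall a b, (a < b)%N -> F a b = G a b) -> qmatrix hbar F = qmatrix hbar G.
Proof.
by move=> eqFG; apply/matrixP => a b; rewrite !mxE; case: ifP => // /eqFG.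
Qed.

(** Only the values of [F] at increasing pairs are meaningful, so the chord of
    an unordered pair is read off the increasing one. *)
Definition chord F i j : A := if (i < j)%N then F i j else F j i.

Lemma chord_lt F i j : (i < j)%N -> chord F i j = F i j.
Proof. by rewrite /chord => ->. Qed.

Lemma chordC F i j : chord F i j = chord F j i.
Proof. by rewrite /chord; case: ltngtP => // /ord_inj ->. Qed.

Definition cyclically_ordered i j k : bool :=
  [|| i < j < k, j < k < i | k < i < j]%N.

Definition skein F : Prop := forall i j k, cyclically_ordered i j k ->
  q *: (chord F i j * chord F j k) - q^-1 *: (chord F j k * chord F i j)
    = xih hbar *: chord F i k.

(** A cyclically ordered triple is increasing when read from one of its three
    members, and each of these cases is one of the three relations. *)
Lemma quantum_geodesic_skein G : quantum_geodesic_functions hbar G -> skein G.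
Proof.
move=> hG i j k /or3P[] /andP[lt1 lt2]; have lt3 := ltn_trans lt1 lt2.
- by rewrite !chord_lt //; apply: (qgeod_ij_jk hG); rewrite lt1.
- rewrite (chordC G i j) (chordC G i k) !chord_lt //.
  by apply: (qgeod_ik_ij hG); rewrite lt1.
- rewrite (chordC G j k) (chordC G i k) !chord_lt //.
  by apply: (qgeod_jk_ik hG); rewrite lt1.
Qed.

(** * Exchange in a triangle *)

(** The inner expression is also [q^-1 (v u) - q^-2 w], by the relation, so that
    the two products cancel and [q^2 q^-2 w] remains: exchanging [w] across
    [v u] undoes exchanging it across [u v]. *)
Lemma qexchange_cancel (u v w : A) :
  q *: (u * v) - q^-1 *: (v * u) = xih hbar *: w ->
  q *: (v * u) - q ^+ 2 *: (q *: (u * v) - q ^+ 2 *: w) = w.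
Proof.
move=> /qexchange ->; rewrite scalerBr !scalerA expr2 mulfK ?qh_neq0 //.
by rewrite -expr2 divff ?expf_neq0 ?qh_neq0 // scale1r opprB addrC subrK.
Qed.

(** Replacing the side [w] of a triangle by its exchange [p] yields a triangle
    again.  Writing [p] with [u v] in one product and with [v u] in the other
    makes the cubic terms of both equal to [u v u]; what is left is the relation
    between [w] and [u]. *)
Lemma qexchange_mutation (u v w : A) (p := q *: (u * v) - q ^+ 2 *: w) :
  q *: (u * v) - q^-1 *: (v * u) = xih hbar *: w ->
  q *: (w * u) - q^-1 *: (u * w) = xih hbar *: v ->
  q *: (u * p) - q^-1 *: (p * u) = xih hbar *: v.
Proof.
move=> rel_uv <-; rewrite {1}/p (qexchange rel_uv) /p mulrBr mulrBl.
rewrite -!scalerAl -!scalerAr !scalerBr !scalerA -mulrA.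
rewrite mulVf ?divff ?qh_neq0 // -exprVn !expr2 mulKf ?mulVKf ?qh_neq0 //.
by rewrite opprB addrC addrA subrK.
Qed.

(** * Half twists and the braid relation *)

(** The braid transformation on entry functions, where compositions can be
    computed without passing through matrices. *)
Definition half_twist x y F : arcs := fun a b =>
  if (a == x) && (b == y) then F x y
  else if a == y then F x b
  else if b == y then F a x
  else if a == x then q *: (F x b * F x y) - q ^+ 2 *: F y b
  else if b == x then q *: (F a x * F x y) - q ^+ 2 *: F a y
  else F a b.

Lemma qbraid_qmatrix (m : 'I_n.-1) F :
  qbraid hbar m (qmatrix hbar F)
    = qmatrix hbar (half_twist (ord_lo m) (ord_hi m) F).
Proof.
apply: eq_qmatrix => a b lt_ab; rewrite /half_twist -!val_eqE /=.
case: ifP => [_|H1]; first by rewrite qmatrixE.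
case: ifP => [/eqP Ea|H2]; first by rewrite qmatrixE //=; lia.
case: ifP => [/eqP Eb|H3]; first by rewrite qmatrixE //=; lia.
case: ifP => [/eqP Ea|H4]; first by rewrite !qmatrixE //=; lia.
case: ifP => [/eqP Eb|H5]; first by rewrite !qmatrixE //=; lia.
by rewrite qmatrixE.
Qed.

(** The proof goes by the places of [a] and [b] with respect to [x], [y], [z].
    Both sides bring [F y z] to the place ([x], [y]) by exchanging it twice, in
    the triangle of [cxy] on the left and in that of [cyz] on the right.  Pairs
    of [x] with a fourth point are compared by [two_twists]; the coefficient
    [F y z] of its left side is again due to [cxy]. *)
Lemma half_twist_braid x y z F : skein F -> (x < y < z)%N ->
  forall a b, (a < b)%N ->
    half_twist x y (half_twist y z (half_twist x y F)) a b
      = half_twist y z (half_twist x y (half_twist y z F)) a b.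
Proof.
move=> hF /andP[lt_xy lt_yz] a b lt_ab; have lt_xz := ltn_trans lt_xy lt_yz.
have rel_xyz : q *: (F x y * F y z) - q^-1 *: (F y z * F x y)
    = xih hbar *: F x z.
  have := hF x y z; rewrite !chord_lt //; apply.
  by rewrite /cyclically_ordered lt_xy lt_yz.
have rel_zxy : q *: (F x z * F x y) - q^-1 *: (F x y * F x z)
    = xih hbar *: F y z.
  have := hF z x y; rewrite 2!(chordC F z) !chord_lt //; apply.
  by rewrite /cyclically_ordered lt_xy lt_yz !orbT.
have two_twists (u v w : A) :
  q *: ((q *: (u * F x y) - q ^+ 2 *: v) * F y z)
    - q ^+ 2 *: (q *: (u * F x z) - q ^+ 2 *: w)
  = q *: (u * (q *: (F x y * F y z) - q ^+ 2 *: F x z))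
    - q ^+ 2 *: (q *: (v * F y z) - q ^+ 2 *: w).
  rewrite mulrBl mulrBr -!scalerAl -!scalerAr !scalerBr !scalerA -mulrA.
  by rewrite [q ^+ 2 * q]mulrC !opprD addrACA.
have neq (c d : 'I_n) : (c < d)%N -> (c == d) = false /\ (d == c) = false.
  by move=> lt_cd; rewrite -!val_eqE /=; lia.
have [[nxy nyx] [nxz nzx] [nyz nzy]] :=
  And3 (neq _ _ lt_xy) (neq _ _ lt_xz) (neq _ _ lt_yz).
pose E := (eqxx, nxy, nyx, nxz, nzx, nyz, nzy, andbF, andbT).
have cxy := qexchange_cancel rel_zxy.
have cyz := qexchange_cancel (qexchange_mutation rel_xyz rel_zxy).
have place c : [\/ c = x, c = y, c = z
    | [/\ (c == x) = false, (c == y) = false & (c == z) = false]].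
  have [->|ncx] := eqVneq c x; first by constructor.
  have [->|ncy] := eqVneq c y; first by constructor.
  by have [->|ncz] := eqVneq c z; constructor.
have order := (ltnn, leq_gtF (ltnW lt_xy), leq_gtF (ltnW lt_xz),
  leq_gtF (ltnW lt_yz)).
case: (place a) lt_ab => [->|->|->|[nax nay naz]];
  case: (place b) => [->|->|->|[nbx nby nbz]] lt_ab.
all: try (rewrite order in lt_ab; discriminate lt_ab).
all: rewrite /half_twist ?nax ?nay ?naz ?nbx ?nby ?nbz !E /=.
all: by rewrite ?cxy ?cyz ?two_twists.
Qed.

(** * Rotation of the marked points *)

Definition rotate F : arcs := fun i j => chord F (ordS i) (ordS j).

Lemma chord_rotate F i j : chord (rotate F) i j = chord F (ordS i) (ordS j).
Proof.
by rewrite {1}/chord /rotate chordC; case: ifP => // _; rewrite chordC.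
Qed.

Lemma val_ordS i : ordS i = (if i.+1 == n then 0 else i.+1)%N :> nat.
Proof.
rewrite /=; have := ltn_ord i; rewrite leq_eqVlt; case: eqP => [->|_ /= lt_in].
  by rewrite modnn.
by rewrite modn_small.
Qed.

(** A cyclic shift preserves cyclic order, whichever of the three points wraps
    around. *)
Lemma skein_rotate F : skein F -> skein (rotate F).
Proof.
move=> hF i j k ijk; rewrite !chord_rotate; apply: hF.
have [lti ltj ltk] := And3 (ltn_ord i) (ltn_ord j) (ltn_ord k).
move: ijk; rewrite /cyclically_ordered !val_ordS.
by do 3!case: eqP => ?; lia.
Qed.

Lemma skein_iter_rotate m F : skein F -> skein (iter m rotate F).
Proof. by move=> hF; elim: m => //= m; apply: skein_rotate. Qed.

Lemma chord_iter_rotate m F i j :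
  chord (iter m rotate F) i j
    = chord F (iter m (@ordS n) i) (iter m (@ordS n) j).
Proof.
elim: m i j => //= m IHm i j.
by rewrite chord_rotate IHm -!iterSr.
Qed.

Lemma iter_ordS m i : iter m (@ordS n) i = ((i + m) %% n)%N :> nat.
Proof.
elim: m => [|m IHm]; first by rewrite addn0 modn_small.
by rewrite iterS /= IHm -addn1 modnDml addn1 addnS.
Qed.

Lemma iter_ordS_id i : iter n (@ordS n) i = i.
Proof. by apply: val_inj; rewrite /= iter_ordS modnDr modn_small. Qed.

End QuantumBraid.

(** * The cycle of half twists is a rotation *)

Section Cycle.

Context (R : realType) (hbar : R) (A : algType R[i]) (n : nat).
Local Notation q := (qh hbar).
Local Notation arcs := ('I_n.+1 -> 'I_n.+1 -> A).
Implicit Types (F G : arcs) (a b i j k x y z : 'I_n.+1).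

Lemma ltn_ordS a : (a < n)%N -> ordS a = a.+1 :> nat.
Proof. by rewrite val_ordS eqSS => /ltn_eqF ->. Qed.

(** Old label of the point at place [a] once the point [0] has been carried past
    the next [m] points: it sits at place [m], and those it has passed have
    moved back by one. *)
Definition moved m a : 'I_n.+1 :=
  if (a < m)%N then ordS a else if a == m :> nat then ord0 else a.

(** Entries after the first [m] half twists.  The chord of [a] and [b] is
    deformed exactly when the moving point, at place [m], separates a point that
    it has passed from one that it has not. *)
Definition swept m F : arcs := fun a b =>
  if (a < m < b)%N
  then q *: (F ord0 b * F ord0 (ordS a)) - q ^+ 2 *: F (ordS a) b
  else chord F (moved m a) (moved m b).

Lemma swept_split F m a b : (a < m < b)%N ->
  swept m F a b = q *: (F ord0 b * F ord0 (ordS a)) - q ^+ 2 *: F (ordS a) b.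
Proof. by rewrite /swept => ->. Qed.

Lemma swept_lt F m a b : (a < b < m)%N -> (m <= n)%N ->
  swept m F a b = F (ordS a) (ordS b).
Proof.
move=> /andP[lt_ab lt_bm] le_mn; have lt_am := ltn_trans lt_ab lt_bm.
rewrite /swept /moved lt_am lt_bm ltnNge (ltnW lt_bm) /= chord_lt //.
by rewrite !ltn_ordS //; lia.
Qed.

Lemma swept_right F m a b : (a < m)%N -> b = m :> nat ->
  swept m F a b = F ord0 (ordS a).
Proof.
move=> lt_am Eb; rewrite /swept /moved lt_am Eb ltnn eqxx chordC chord_lt //.
by rewrite ltn_ordS //; have := ltn_ord b; lia.
Qed.

Lemma swept_left F m a b : (m < b)%N -> a = m :> nat ->
  swept m F a b = F ord0 b.
Proof.
move=> lt_mb Ea; rewrite /swept /moved Ea ltnn eqxx gtn_eqF //.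
by rewrite (ltnNge b) (ltnW lt_mb) chord_lt //=; lia.
Qed.

Lemma swept_gt F m a b : (m < a < b)%N -> swept m F a b = F a b.
Proof.
move=> /andP[lt_ma lt_ab]; have lt_mb := ltn_trans lt_ma lt_ab.
rewrite /swept /moved (leq_gtF (ltnW lt_ma)) (leq_gtF (ltnW lt_mb)) /=.
by rewrite !gtn_eqF // chord_lt.
Qed.

Lemma swept0 F a b : (a < b)%N -> swept 0 F a b = F a b.
Proof.
move=> lt_ab; have [a0|a_gt0] := posnP a; last by rewrite swept_gt ?a_gt0.
by rewrite swept_left //; [congr (F _ _); apply: ord_inj | lia].
Qed.

Lemma swept_max F a b : (a < b)%N -> swept n F a b = rotate F a b.
Proof.
move=> lt_ab; have := ltn_ord b; rewrite ltnS leq_eqVlt.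
case/orP => [/eqP Eb|lt_bn]; rewrite /rotate.
  have ordSb : ordS b = ord0 by apply: ord_inj; rewrite val_ordS Eb eqxx.
  have lt_an : (a < n)%N by move: lt_ab; rewrite Eb.
  by rewrite swept_right // ordSb chordC chord_lt // ltn_ordS.
have lt_an := ltn_trans lt_ab lt_bn.
by rewrite swept_lt ?lt_ab // chord_lt // !ltn_ordS.
Qed.

(** All entries match by definition except at ([a], [x]) with [a < x]: there the
    moving point leaves the gap between the two ends, and the deformed chord is
    restored by [qexchange_cancel] in the triangle formed by the point [0] and
    these ends. *)
Lemma half_twist_swept F x y a b : skein hbar F -> y = x.+1 :> nat ->
  (a < b)%N -> half_twist hbar x y (swept x F) a b = swept y F a b.
Proof.
move=> hF Ey lt_ab; have lt_bn := ltn_ord b; have lt_yn := ltn_ord y.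
have lt_xy : (x < y)%N by rewrite Ey.
have ordSx : ordS x = y by apply: ord_inj; rewrite ltn_ordS -?Ey // -ltnS -Ey.
have eqx c : (c == x) = (c == x :> nat) by [].
have eqy c : (c == y) = (c == y :> nat) by [].
rewrite /half_twist; case: (ltngtP a x) => Eax.
- have -> : (a == x) = false by rewrite eqx; lia.
  have -> /= : (a == y) = false by rewrite eqy; lia.
  have [->|nby] := eqVneq b y.
    by rewrite (swept_right _ Eax) // swept_right //; lia.
  have [Eb|nbx] := eqVneq b x.
    rewrite {b nby lt_bn}Eb in lt_ab *.
    have -> : swept y F a x = F (ordS a) y.
      by rewrite swept_lt ?ordSx ?lt_ab //; lia.
    rewrite (swept_right F Eax) // (swept_left F lt_xy) // swept_split ?Eax //.
    apply: qexchange_cancel.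
    have lt_ay : (ordS a < y)%N by rewrite ltn_ordS; lia.
    have lt_0a : (ord0 < ordS a)%N by rewrite ltn_ordS //; lia.
    have := hF y ord0 (ordS a); rewrite 2!(chordC F y) !chord_lt //.
      by apply; rewrite /cyclically_ordered lt_0a lt_ay !orbT.
    exact: ltn_trans lt_ay.
  rewrite eqx in nbx; rewrite eqy in nby.
  have [lt_bx|le_xb] := ltnP b x; first by rewrite !swept_lt ?lt_ab //; lia.
  by rewrite !swept_split //; lia.
- have -> : (a == x) = false by rewrite eqx; lia.
  have -> : (b == x) = false by rewrite eqx; lia.
  have -> /= : (b == y) = false by rewrite eqy; lia.
  have [Ea|nay] := eqVneq a y.
    by rewrite {}Ea in lt_ab Eax *; rewrite !swept_left //; lia.
  by rewrite eqy in nay; rewrite !swept_gt //; lia.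
- have {}Eax := ord_inj Eax; rewrite {a}Eax eqxx /= in lt_ab *.
  have -> : (x == y) = false by rewrite eqy; lia.
  have [->|nby] := eqVneq b y.
    by rewrite (swept_left F lt_xy) // (swept_right F lt_xy) ?ordSx.
  rewrite eqy in nby; have lt_yb : (y < b)%N by lia.
  rewrite (swept_left F lt_ab) // (swept_left F lt_xy) //.
  by rewrite swept_gt ?lt_xy // swept_split ?lt_xy // ordSx.
Qed.

Lemma qbraid_cycle_qmatrix F : skein hbar F ->
  qbraid_cycle hbar (n := n.+1) (qmatrix hbar F) = qmatrix hbar (rotate F).
Proof.
move=> hF; rewrite /qbraid_cycle.
suff sweep m : (m <= n)%N ->
    (\big[(fun f g : 'M[A]_n.+1 -> 'M[A]_n.+1 => f \o g) / id]_(
        k <- rev (take m (enum 'I_n))) qbraid hbar (k : 'I_n.+1.-1))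
      (qmatrix hbar F) = qmatrix hbar (swept m F).
  have := sweep n (leqnn n); rewrite take_oversize ?size_enum_ord // => ->.
  by apply: eq_qmatrix => a b; apply: swept_max.
elim: m => [_|m IHm lt_mn].
  by rewrite take0 big_nil; apply/esym/eq_qmatrix => a b; apply: swept0.
pose k := Ordinal lt_mn.
rewrite (take_nth k) ?size_enum_ord // rev_rcons big_cons /=.
rewrite IHm ?(ltnW lt_mn) // (nth_ord_enum k k) qbraid_qmatrix.
by apply: eq_qmatrix => a b; apply: half_twist_swept.
Qed.

Lemma iter_qbraid_cycle m F : skein hbar F ->
  iter m (qbraid_cycle hbar (n := n.+1)) (qmatrix hbar F)
    = qmatrix hbar (iter m (@rotate R A n.+1) F).
Proof.
move=> hF; elim: m => //= m ->.
by rewrite qbraid_cycle_qmatrix //; apply: skein_iter_rotate.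
Qed.

End Cycle.

Theorem lemma12 (R : realType) (hbar : R) (hbar_gt0 : 0 < hbar)
    (A : algType R[i]) (n : nat) (n_ge3 : (3 <= n)%N)
    (G : 'I_n -> 'I_n -> A) (hG : quantum_geodesic_functions hbar G) :
  (forall k l : 'I_n.-1, l = k.+1 :> nat ->
     (qbraid hbar k \o qbraid hbar l \o qbraid hbar k) (qmatrix hbar G)
       = (qbraid hbar l \o qbraid hbar k \o qbraid hbar l) (qmatrix hbar G))
  /\ iter n (qbraid_cycle hbar (n := n)) (qmatrix hbar G) = qmatrix hbar G.
Proof.
have hF := quantum_geodesic_skein hG; split=> [k l Ekl|].
  have Em : ord_hi k = ord_lo l by apply: val_inj.
  rewrite /= !qbraid_qmatrix Em; apply: eq_qmatrix => a b lt_ab.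
  by apply: half_twist_braid => //; rewrite /= Ekl !leqnn.
case: n n_ge3 G hG hF => // n _ G _ hF.
rewrite iter_qbraid_cycle //; apply: eq_qmatrix => a b lt_ab.
by rewrite -(chord_lt _ lt_ab) chord_iter_rotate !iter_ordS_id chord_lt.
Qed.
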